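(* Let $S$ be an affine semigroup endowed with the discrete topology, and let $S_\infty = S\cup\{\infty\}$ be endowed with the one-point compactification topology. Then the semigroup $S_\infty$ is a topological semigroup if and only if $S$ is pointed.
   Context: An affine semigroup is a commutative semigroup $S$ (written additively) with identity $0$ which is finitely generated (there is a finite $A\subset S$ with $S=\{\sum_{a\in A}\alpha_a a\mid \alpha_a\in\mathbb{N}\}$, where $0\in\mathbb{N}$) and embeddable in a lattice $\mathbb{Z}^n$ for some $n\ge 0$; in particular it is cancellative. $S$ is pointed if $\{0\}$ is a face of $S$, equivalently: $a+b=0$ with $a,b\in S$ implies $a=b=0$. $S_\infty=S\cup\{\infty\}$ is the semigroup whose operation extends that of $S$ by $a+\infty=\infty+a=\infty$ for all $a\in S_\infty$. The one-point compactification topology on $S_\infty$ (with $S$ discrete) is the one whose open sets are the subsets of $S$ and the sets $S_\infty\setminus C$ with $C\subset S$ compact (i.e. finite). A topological semigroup is a semigroup $T$ with a topology such that the operation $+\colon T\times T\to T$ is continuous, where $T\times T$ has the product topology. *)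

(* Defs.v *)
From HB Require Import structures.
From mathcomp Require Import all_boot all_algebra finmap.
From mathcomp Require Import all_classical topology.

Set Implicit Arguments.
Unset Strict Implicit.
Unset Printing Implicit Defensive.

Import GRing.Theory.
Local Open Scope classical_set_scope.
Local Open Scope ring_scope.

Definition finitely_generated (S : nmodType) : Prop :=
  exists A : {fset S}, forall s : S,
    exists alpha : S -> nat, s = \sum_(a <- A) a *+ alpha a.

(* Preservation of 0, part of {additive _ -> _}, is automatic for a semigroup
   homomorphism into a group. *)
Definition lattice_embeddable (S : nmodType) : Prop :=
  exists (n : nat) (f : {additive S -> 'rV[int]_n}), injective f.

Definition affine_semigroup (S : nmodType) : Prop :=
  finitely_generated S /\ lattice_embeddable S.

Definition semigroup_face (S : nmodType) (F : set S) : Prop :=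
  [/\ F 0, forall a b, F a -> F b -> F (a + b)
    & forall a b, F (a + b) -> F a /\ F b].

Definition pointed_semigroup (S : nmodType) : Prop := semigroup_face [set 0 : S].

Lemma pointed_semigroupP (S : nmodType) :
  pointed_semigroup S <-> forall a b : S, a + b = 0 -> a = 0 /\ b = 0.
Proof.
by split=> [[_ _]//|h]; split=> // a b -> ->; rewrite /= addr0.
Qed.

(* The underlying type is option S, with None in the role of oo; S is given
   the discrete topology whatever other structure it may carry. *)
Definition adjoin_infty (S : nmodType) : Type :=
  one_point_compactification (discrete_topology S).

HB.instance Definition _ (S : nmodType) := Topological.copy (adjoin_infty S)
  (one_point_compactification (discrete_topology S)).

Section AdjoinInfty.
Variable S : nmodType.
Local Notation Soo := (adjoin_infty S).

Definition add_infty (x y : Soo) : Soo :=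
  if x is Some a then if y is Some b then Some ((a : S) + (b : S)) else None
  else None.

Definition zero_infty : Soo := Some (0 : S).

Fact add_inftyA : associative add_infty.
Proof. by move=> [a|] [b|] [c|] //=; rewrite addrA. Qed.

Fact add_inftyC : commutative add_infty.
Proof. by move=> [a|] [b|] //=; rewrite addrC. Qed.

Fact add_0infty : left_id zero_infty add_infty.
Proof. by move=> [a|] //=; rewrite add0r. Qed.

HB.instance Definition _ :=
  GRing.isNmodule.Build Soo add_inftyA add_inftyC add_0infty.

Lemma adjoin_infty_openP (U : set Soo) :
  open U <-> ~ U None \/ exists2 C : set S, finite_set C & U = ~` (Some @` C).
Proof.
have compactP (C : set (discrete_topology S)) : compact C -> finite_set C.
  move=> /compact_near_coveringP cC.
  pose F := filter_from (@finite_set S) (fun D => [set E : set S | D `<=` E]).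
  have FF : Filter F.
    apply: filter_from_filter; first by exists set0; exact: finite_set0.
    move=> D1 D2 fD1 fD2; exists (D1 `|` D2); first by rewrite finite_setU.
    by move=> E /= sE; split=> x Dx; apply: sE; [left|right].
  have [x Cx|D fD /(_ D) CD] := cC _ F (fun E x => E x) FF.
    exists ([set x], [set E : set S | E x]) => /=; last by case=> y E /= [->].
    split; first exact: discrete_set1.
    exists [set x]; first exact: finite_set1.
    by move=> E; apply.
  by apply: sub_finite_set fD; apply: CD => x.
split=> [oU|].
  have [UN|] := pselect (U None); [right|by left].
  have [K [/compactP fK _] KU] : nbhs (None : Soo) U by exact: open_nbhs_nbhs.
  exists [set a | ~ U (Some a)].
    apply: sub_finite_set fK => a /=; apply: contra_notP => Ka.
    by apply: KU; left; exists a.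
  apply/seteqP; split=> [x Ux [a nUa ax]|[a|//]]; first by rewrite -ax in Ux.
  by move=> h; apply: contrapT => nUa; apply: h; exists a.
rewrite openE => UE x Ux; rewrite /interior.
case: x Ux => [a|] Ux.
  suff : nbhs (a : discrete_topology S) [set b : S | U (Some b)] by [].
  by rewrite nbhs_principalE; exact/principal_filterP.
case: UE => [//|[C fC ->]].
exists (C : set (discrete_topology S)).
  by split; [exact: finite_compact|exact: discrete_closed].
move=> y /= [[a nCa <-]|->] [b Cb //] [ba]; apply: nCa; by rewrite -ba.
Qed.

End AdjoinInfty.

Definition topological_semigroup (T : topologicalType) (op : T -> T -> T) :
    Prop :=
  associative op /\ continuous (fun z : T * T => op z.1 z.2).

(* Main.v *)
(** In a finitely generated commutative monoid every sequence has a subsequence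
along which each term divides (additively) the later ones: by Dickson's lemma
the coefficient vectors can be made nondecreasing.  Hence, in a cancellative
pointed monoid, an element [c] has only finitely many summands: along
infinitely many decompositions [c = x n + y n] one would find
[x j = x i + d] and [y j = y i + e] with [d + e = 0], so [x i = x j].  This is
continuity at [(oo, oo)]; continuity at [(a, oo)] is cancellation.  Conversely,
if [a + b = 0] with [a], [b] nonzero, then by torsion-freeness the multiples of
[a] and of [b] both tend to [oo], while their sums stay at [0]. *)
Require Import Defs.
From mathcomp Require Import all_boot all_algebra all_classical topology.

Import GRing.Theory Num.Theory.
Local Open Scope classical_set_scope.
Local Open Scope ring_scope.

(** Every tail of [u] attains its minimum; [phi] repeatedly picks a minimiser in the tail strictly
    beyond the previous pick. *)
Lemma nondecreasing_subseq (u : nat -> nat) :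
  exists2 phi : nat -> nat, {homo phi : i j / (i < j)%N} &
    {homo u \o phi : i j / (i <= j)%N}.
Proof.
have argmin n : exists m, (n <= m)%N /\ forall k, (n <= k)%N -> (u m <= u k)%N.
  have ex : exists v, `[< exists2 m, (n <= m)%N & u m = v >].
    by exists (u n); apply/asboolP; exists n.
  case: (ex_minnP ex) => v /asboolP[m nm <-] umin.
  by exists m; split=> // k nk; apply: umin; apply/asboolP; exists k.
have [g /all_and2[gge gmin]] := choice argmin.
exists (fun n => iter n (fun k => g k.+1) (g 0%N)).
  by apply: homo_ltn => [|i]; [exact: ltn_trans|exact: gge].
apply: homo_leq => [//||i /=]; first exact: leq_trans.
(* The first pick minimises [u] over all indices, a later one only beyond its predecessor, hence the
   two cases. *)
case: i => [|i] /=; apply: gmin => //.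
exact: leq_trans (gge _) (ltnW (gge _)).
Qed.

(** Dickson's lemma, one coordinate at a time: a further extraction keeps the earlier coordinates
    nondecreasing. *)
Lemma nondecreasing_subseq_family {T : eqType} (s : seq T)
    (f : nat -> T -> nat) :
  exists2 phi : nat -> nat, {homo phi : i j / (i < j)%N} &
    {in s, forall a, {homo (fun n => f (phi n) a) : i j / (i <= j)%N}}.
Proof.
elim: s => [|a s [phi phi_lt phi_le]]; first by exists id.
have [psi psi_lt psi_le] := nondecreasing_subseq (fun n => f (phi n) a).
exists (phi \o psi) => [i j /psi_lt/phi_lt //|b].
rewrite inE => /orP[/eqP->|sb i j ij]; first exact: psi_le.
by apply: phi_le => //; exact: (ltnW_homo psi_lt).
Qed.

Lemma infinite_set_inj_seq {T : Type} (A : set T) : infinite_set A ->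
  exists2 x : nat -> T, injective x & forall n, A (x n).
Proof.
elim/Ppointed: T => T in A *; first by rewrite emptyE.
move=> /infiniteP/pcard_leP[x]; exists x => [i j|n]; last exact: funS.
by apply: (inj (f := x)); rewrite inE.
Qed.

Section AffineSemigroup.
Variable S : nmodType.

Lemma finitely_generated_subseq (x : nat -> S) : finitely_generated S ->
  exists2 phi : nat -> nat, {homo phi : i j / (i < j)%N} &
    forall i j, (i < j)%N -> exists d, x (phi j) = x (phi i) + d.
Proof.
move=> [A genA].
have [al alE] := choice (fun n => genA (x n)).
have [phi phi_lt phi_le] := nondecreasing_subseq_family (finmap.enum_fset A) al.
exists phi => // i j ij.
(* The truncated subtraction is exact because the coefficients are nondecreasing along [phi]. *)
exists (\sum_(a <- finmap.enum_fset A) a *+ (al (phi j) a - al (phi i) a)).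
rewrite !alE -big_split; apply: eq_big_seq => a aA /=.
by rewrite -mulrnDr subnKC// phi_le// ltnW.
Qed.

Lemma lattice_embeddable_addrI : lattice_embeddable S ->
  right_injective (+%R : S -> S -> S).
Proof.
by move=> [n [f injf]] a b c /(congr1 f); rewrite !raddfD => /addrI/injf.
Qed.

(** Some coordinate of [f a] is a nonzero integer, whose multiples are distinct. *)
Lemma lattice_embeddable_mulrIn (a : S) : lattice_embeddable S -> a <> 0 ->
  injective (GRing.natmul a).
Proof.
move=> [n [f injf]] a0 k l kl.
have /rV0Pn[i fai] : f a != 0 by apply/eqP => fa0; apply/a0/injf; rewrite raddf0.
apply: (mulrIn fai); have := congr1 (fun s => f s 0 i) kl.
by rewrite !raddfMn !mulmxnE.
Qed.

Lemma finite_summands (c : S) : affine_semigroup S -> pointed_semigroup S ->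
  finite_set [set x | exists y, x + y = c].
Proof.
move=> [fgS /lattice_embeddable_addrI addI] /pointed_semigroupP pS.
apply: contrapT => /infinite_set_inj_seq[x injx /choice[y xy]].
have [phi phi_lt xphi] := finitely_generated_subseq x fgS.
have [psi psi_lt yphi] := finitely_generated_subseq (y \o phi) fgS.
have [d xd] := xphi _ _ (psi_lt _ _ (ltnSn 0)).
have [e /= ye] := yphi _ _ (ltnSn 0).
have /pS[d0 _] : d + e = 0.
  (* Adding [d + e] to one decomposition of [c] gives another decomposition of [c]; cancel [c]. *)
  apply: (addI c); rewrite addr0 -[in LHS](xy (phi (psi 0%N))) addrACA -xd -ye.
  exact: xy.
move: xd; rewrite d0 addr0 => /injx E.
by have := phi_lt _ _ (psi_lt _ _ (ltnSn 0)); rewrite E ltnn.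
Qed.

Lemma nbhs_inftyP (U : set (adjoin_infty S)) :
  nbhs (None : adjoin_infty S) U <->
  U None /\ finite_set [set a : S | ~ U (Some a)].
Proof.
rewrite nbhsE; split=> [[V [/adjoin_infty_openP oV VN] VU]|[UN finU]].
  split; first exact: VU.
  case: oV => [//|[C finC VE]]; apply: sub_finite_set finC => a nUa.
  apply: contrapT => nCa; apply/nUa/VU; rewrite VE => -[b Cb [ba]].
  by apply: nCa; rewrite -ba.
exists U => //; split=> //; apply/adjoin_infty_openP; right.
exists [set a : S | ~ U (Some a)] => //.
apply/seteqP; split=> [x Ux [a nUa ax]|[a|//]]; first by rewrite -ax in Ux.
by move=> h; apply: contrapT => nUa; apply: h; exists a.
Qed.

Lemma nbhs_SomeP (a : S) (U : set (adjoin_infty S)) :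
  nbhs (Some a : adjoin_infty S) U <-> U (Some a).
Proof.
split=> [/nbhs_singleton //|Ua]; rewrite nbhsE.
exists [set (Some a : adjoin_infty S)]; last by move=> _ ->.
by split=> //; apply/adjoin_infty_openP; left.
Qed.

Lemma topological_semigroup_pointed : affine_semigroup S ->
  topological_semigroup
    (+%R : adjoin_infty S -> adjoin_infty S -> adjoin_infty S) ->
  pointed_semigroup S.
Proof.
move=> [_ embS] [_ addC]; apply/pointed_semigroupP => a b ab0.
apply: contrapT => nab0.
have a0 : a <> 0.
  by move=> a0; apply: nab0; move: ab0; rewrite a0 add0r.
have b0 : b <> 0.
  by move=> b0; apply: nab0; move: ab0; rewrite b0 addr0.
(* This neighbourhood excludes [0], the value of every [a *+ n + b *+ n]. *)
have nbhs0 : nbhs (None : adjoin_infty S) (~` [set Some (0 : S)]).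
  apply/nbhs_inftyP; split=> //; apply: (sub_finite_set _ (finite_set1 (0 : S))).
  by move=> x /= /contrapT[].
have [[/= V W] [/nbhs_inftyP[_ finV] /nbhs_inftyP[_ finW]] VW] :=
  addC (None, None) _ nbhs0.
have finM (c : S) (D : set S) : c <> 0 -> finite_set D ->
    finite_set (GRing.natmul c @^-1` D).
  by move=> c0; apply: finite_preimage => i j _ _; exact: lattice_embeddable_mulrIn.
(* Only finitely many [n] put [a *+ n] outside [V] or [b *+ n] outside [W]. *)
have [n [_ /not_orP[nVa nWb]]] : [set: nat] `\`
    (GRing.natmul a @^-1` [set x | ~ V (Some x)] `|`
     GRing.natmul b @^-1` [set x | ~ W (Some x)]) !=set0.
  apply/infinite_setN0/infinite_setD; first exact: infinite_nat.
  by rewrite finite_setU; split; exact: finM.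
have /= := VW (Some (a *+ n), Some (b *+ n)) (conj (contrapT nVa) (contrapT nWb)).
by apply; congr Some; rewrite -mulrnDl ab0 mul0rn.
Qed.

Lemma pointed_topological_semigroup : affine_semigroup S ->
  pointed_semigroup S ->
  topological_semigroup
    (+%R : adjoin_infty S -> adjoin_infty S -> adjoin_infty S).
Proof.
move=> affS pS; split; first exact: addrA.
have addI := lattice_embeddable_addrI (proj2 affS).
have cont_infty (a : S) (U : set (adjoin_infty S)) :
    nbhs (None : adjoin_infty S) U ->
    nbhs (None : adjoin_infty S)
      [set y : adjoin_infty S | U ((Some a : adjoin_infty S) + y)].
  move=> /nbhs_inftyP[UN finU]; apply/nbhs_inftyP; split=> //.
  by apply: (finite_preimage (f := +%R a)) finU => x y _ _; exact: addI.
move=> [[a|] [b|]] U /= nU.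
- exists ([set Some a], [set Some b]); first by split; apply/nbhs_SomeP.
  by move=> [x y] /= [-> ->]; exact: nbhs_singleton nU.
- exists ([set Some a], [set y | U ((Some a : adjoin_infty S) + y)]).
    by split; [apply/nbhs_SomeP|exact: cont_infty].
  by move=> [x y] /= [->].
- exists ([set y | U ((Some b : adjoin_infty S) + y)], [set Some b]).
    by split; [exact: cont_infty|apply/nbhs_SomeP].
  by move=> [x y] /= [Uy ->]; rewrite addrC.
- have /nbhs_inftyP[UN finU] := nU.
  (* [D] holds all summands of the finitely many elements missed by [U]. Outside [D], adding
     anything stays in [U], so the second factor can be the whole space. *)
  pose D := \bigcup_(c in [set c : S | ~ U (Some c)]) [set x | exists y, x + y = c].
  have finD : finite_set D by apply: bigcup_finite => // c _; exact: finite_summands.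
  exists (~` (Some @` D), setT).
    split; last exact: filterT.
    apply/nbhs_inftyP; split; first by case.
    by apply: sub_finite_set finD => x /contrapT[z Dz [<-]].
  move=> [[x|] [y|]] //= [nDx _]; apply: contrapT => nUxy.
  by apply: nDx; exists x => //; exists (x + y) => //; exists y.
Qed.

End AffineSemigroup.

Theorem theorem2p6 (S : nmodType) (hS : affine_semigroup S) :
  topological_semigroup (+%R : adjoin_infty S -> adjoin_infty S -> adjoin_infty S)
    <-> pointed_semigroup S.
Proof.
split; first exact: topological_semigroup_pointed.
exact: pointed_topological_semigroup.
Qed.
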